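(* Let $p,q\in(1,\infty)$. If $k>-1$, $\ell>1-p$ (real numbers) and $x\in[0,\pi_{p,q}/2]$, then \[\int_0^x\sin_{p,q}^k t\,\cos_{p,q}^\ell t\,dt=\frac{1}{k+1}\sin_{p,q}^{k+1}x\;F\left(\frac{k+1}{q},\frac{1-\ell}{p};1+\frac{k+1}{q};\sin_{p,q}^q x\right).\] In particular, \[\int_0^{\pi_{p,q}/2}\sin_{p,q}^k t\,\cos_{p,q}^\ell t\,dt=\frac1q B\left(\frac{k+1}{q},1+\frac{\ell-1}{p}\right).\]
   Context: Generalized trigonometric functions: for $p,q\in(1,\infty)$, $\sin_{p,q}$ is the inverse function of $\sin_{p,q}^{-1}x:=\int_0^x \frac{dt}{(1-t^q)^{1/p}}$, $0\le x\le 1$, and $\pi_{p,q}:=2\sin_{p,q}^{-1}1=2\int_0^1\frac{dt}{(1-t^q)^{1/p}}$. Thus $\sin_{p,q}$ is increasing from $[0,\pi_{p,q}/2]$ onto $[0,1]$. One sets $\cos_{p,q}x:=(\sin_{p,q}x)'$, which satisfies $\cos_{p,q}^p x+\sin_{p,q}^q x=1$ with $\cos_{p,q}x\ge 0$ on $[0,\pi_{p,q}/2]$. Powers are written $\sin_{p,q}^a x=(\sin_{p,q}x)^a$, $\cos_{p,q}^a x=(\cos_{p,q}x)^a$; integrals are improper where an exponent is negative. $B(x,y)=\int_0^1t^{x-1}(1-t)^{y-1}\,dt$ for $x,y>0$ is the beta function. The Gaussian hypergeometric function is $F(a,b;c;x):=\sum_{n=0}^\infty\frac{(a)_n(b)_n}{(c)_n}\frac{x^n}{n!}$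 for $|x|<1$, where $(a)_0:=1$ and $(a)_n:=a(a+1)\cdots(a+n-1)$ for $n\ge1$; at $x=1$ it denotes the sum of this series, which converges when $c>a+b$ (as is the case here). *)

(* Defs.v *)
From mathcomp Require Import all_boot all_order all_algebra.
From mathcomp Require Import all_classical all_reals all_analysis.
Import Order.TTheory GRing.Theory Num.Theory.
Import numFieldNormedType.Exports.

Set Implicit Arguments.
Unset Strict Implicit.
Unset Printing Implicit Defensive.

Local Open Scope classical_set_scope.
Local Open Scope ring_scope.

(* All integrands below are nonnegative, so that the Lebesgue integral over a
   closed interval agrees with the improper Riemann integral. The value of the
   integrands at the endpoints (where [0 `^ a] is [0] for [a != 0]) is
   irrelevant. *)

Definition arcsin_pq (R : realType) (p q x : R) : R :=
  \int[lebesgue_measure]_(t in `[0, x]) ((1 - t `^ q) `^ p^-1)^-1.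

Definition pi_pq (R : realType) (p q : R) : R := 2 * arcsin_pq p q 1.

(* Meaningful on [0, pi_pq p q / 2] only. *)
Definition sin_pq (R : realType) (p q y : R) : R :=
  get [set x | 0 <= x <= 1 /\ arcsin_pq p q x = y].

(* Derivative of sin_pq as a function on the closed interval
   [0, pi_pq p q / 2]: one-sided at the endpoints, equal to the usual
   derivative in the interior. *)
Definition cos_pq (R : realType) (p q x : R) : R :=
  lim ((sin_pq p q y - sin_pq p q x) / (y - x)
         @[y --> within `[0, pi_pq p q / 2] x^']).

(* The library's beta_fun is restricted to natural arguments. *)
Definition beta (R : realType) (x y : R) : R :=
  \int[lebesgue_measure]_(t in `[0, 1]) (t `^ (x - 1) * (1 - t) `^ (y - 1)).

Definition pochhammer (R : realType) (a : R) (n : nat) : R :=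
  \prod_(i < n) (a + i%:R).

(* The sum of the series as a limit of partial sums in R, including at x = 1. *)
Definition hypergeo (R : realType) (a b c x : R) : R :=
  limn (series (fun n => pochhammer a n * pochhammer b n / pochhammer c n
                         * (x ^+ n / n`!%:R))).

(* Main.v *)
Require Import Defs.
From mathcomp Require Import all_boot all_order all_algebra.
From mathcomp Require Import all_classical all_reals all_analysis.
From mathcomp Require Import measurable_realfun ring lra.
Import Order.TTheory GRing.Theory Num.Theory.
Import numFieldNormedType.Exports.

Local Open Scope classical_set_scope.
Local Open Scope ring_scope.

(* The substitution [s = sin_pq t] turns the integral into that of
   [s ^ k * (1 - s ^ q) ^ (- b)] over [0, sin_pq x], where [b = (1 - l) / p < 1].
   Expanding the second factor in its binomial series and integrating term by
   term gives the hypergeometric series; dominated convergence justifies this up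
   to the endpoint [1], because all late partial sums of the binomial series of
   [(1 - u) ^ (- b)] are bounded by [C + (1 - u) ^ (- b)].  For the complete
   integral, [u = s ^ q] gives the beta function.  Every substitution takes place
   on an open interval, which is exhausted by compact ones on account of the
   singularities at the endpoints. *)

(** * Substitution on open intervals *)

Lemma bigcup_segment_oo (R : realType) (a b : R) : a < b ->
  exists u v : nat -> R,
  [/\ forall n, u n \in `]a, b[, forall n, v n \in `]a, b[,
      forall n, u n < v n,
      nondecreasing_seq (fun n => `[u n, v n]%classic) &
      \bigcup_n `[u n, v n]%classic = `]a, b[%classic].
Proof.
move=> ab.
(* The denominator starts at 3 so that [2 * e n < b - a], which keeps every segment
   [[a + e n, b - e n]] nondegenerate. *)
pose e n : R := (b - a) / n.+3%:R.
have ba0 : 0 < b - a by rewrite subr_gt0.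
have e0 n : 0 < e n by rewrite divr_gt0.
have e2 n : e n * 2 < b - a.
  by rewrite /e mulrAC ltr_pdivrMr// ltr_pM2l// ltr_nat.
have ele n m : (n <= m)%N -> e m <= e n.
  by move=> nm; rewrite ler_pM2l// lef_pV2 ?posrE// ler_nat !ltnS.
exists (fun n => a + e n), (fun n => b - e n); split.
- by move=> n; rewrite in_itv/=; have := e0 n; have := e2 n; lra.
- by move=> n; rewrite in_itv/=; have := e0 n; have := e2 n; lra.
- by move=> n; have := e0 n; have := e2 n; lra.
- move=> n m nm; rewrite subsetEset => x/=; rewrite !in_itv/=.
  by have := ele _ _ nm; lra.
- apply/seteqP; split => [x [n _]/=|x/=]; rewrite !in_itv/=.
    by have := e0 n; have := e2 n; lra.
  move=> /andP[ax xb].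
  have [|n] := @ltr_add_invr R 0 (Num.min (x - a) (b - x) / (b - a)).
    by rewrite divr_gt0// lt_min !subr_gt0 ax.
  rewrite add0r ltr_pdivlMr// lt_min mulrC => nx.
  exists n => //=; rewrite in_itv/=.
  have : e n <= (b - a) / n.+1%:R.
    by rewrite ler_pM2l// lef_pV2 ?posrE// ler_nat !ltnS// ltnW.
  move: nx; set h := (b - a) / n.+1%:R; move: (e n) (h) => en h' /andP[]; lra.
Qed.

(** On each compact segment this is the classical substitution rule. Since [G] is nonnegative,
    monotone convergence along an exhaustion passes to the open intervals, and both sides may be
    infinite. The image hypothesis makes the images of the segments exhaust []c, d[]. *)
Lemma ge0_integration_by_substitution_oo (R : realType) (F f G : R -> R)
    (a b c d : R) : a < b ->
  (forall x, x \in `]a, b[ -> is_derive x 1 F (f x)) ->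
  {in `]a, b[, continuous f} ->
  (forall x, x \in `]a, b[ -> 0 < f x) ->
  F @` `]a, b[%classic = `]c, d[%classic ->
  {in `]c, d[, continuous G} ->
  (forall x, x \in `]c, d[ -> 0 <= G x) ->
  (\int[lebesgue_measure]_(x in `]c, d[) (G x)%:E =
   \int[lebesgue_measure]_(x in `]a, b[) (G (F x) * f x)%:E)%E.
Proof.
move=> ab dF cf f0 im cG G0.
have F'E x : x \in `]a, b[ -> F^`()%classic x = f x.
  by move=> /dF ?; rewrite derive1E derive_val.
have DF x : x \in `]a, b[ -> derivable F x 1 by move=> /dF[].
have cF x : x \in `]a, b[ -> {for x, continuous F}.
  by move=> /DF/derivable1_diffP/differentiable_continuous.
have incrF : {in `]a, b[ &, {homo F : x y / x < y}}.
  apply: gtr0_derive1_lt_oo => //; first by move=> x xab; rewrite F'E// f0.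
  by move=> x; rewrite inE => /cF.
have Fcd x : x \in `]a, b[ -> F x \in `]c, d[.
  move=> xab; suff : `]c, d[%classic (F x) by [].
  by rewrite -im; exists x.
have leF : {in `]a, b[ &, {mono F : x y / x <= y}} by exact: le_mono_in.
have [u [v [uab vab uv ndcc bcup]]] := @bigcup_segment_oo R a b ab.
have cc n x : x \in `[u n, v n] -> x \in `]a, b[.
  move: (uab n) (vab n); rewrite !in_itv/=; lra.
(* A point between [F (u n)] and [F (v n)] has a preimage in []a, b[]; as [F] reflects the order, it
   lies in the segment. *)
have segF n : F @` `[u n, v n]%classic = `[F (u n), F (v n)]%classic.
  apply/seteqP; split => [_ [x xuv <-]|y]/=.
    move: xuv (cc _ _ xuv) => /=; rewrite in_itv/= => /andP[ux xv] xab.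
    by rewrite in_itv/= !leF ?ux ?xv.
  rewrite in_itv/= => /andP[uy yv].
  have ycd : y \in `]c, d[.
    move: (Fcd _ (uab n)) (Fcd _ (vab n)) uy yv; rewrite !in_itv/=; lra.
  have [x xab xy] : (F @` `]a, b[%classic) y by rewrite im.
  exists x => //; rewrite /= in_itv/= -(leF (u n))// -(leF x (v n))//.
  by rewrite xy uy yv.
have mG : measurable_fun `]c, d[ G.
  apply: open_continuous_measurable_fun => //.
  by move=> x; rewrite inE => /cG.
have cGF x : x \in `]a, b[ -> {for x, continuous (fun x => G (F x) * f x)}.
  move=> xab; apply: cvgM; last exact: cf.
  by apply: continuous_comp; [exact: cF|exact/cG/Fcd].
have mGF : measurable_fun `]a, b[ (fun x => G (F x) * f x).
  apply: open_continuous_measurable_fun => //.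
  by move=> x; rewrite inE => /cGF.
have subcd n : `[F (u n), F (v n)]%classic `<=` `]c, d[%classic.
  by rewrite -segF -im; apply: image_subset => x /cc.
have h1 : (\int[lebesgue_measure]_(x in `[F (u n), F (v n)]) (G x)%:E)%E
  @[n --> \oo] --> (\int[lebesgue_measure]_(x in `]c, d[) (G x)%:E)%E.
  have -> : `]c, d[%classic = \bigcup_n `[F (u n), F (v n)]%classic.
    by rewrite -im -bcup image_bigcup; apply: eq_bigcupr => n _.
  apply: ge0_nondecreasing_set_cvg_integral => //.
  - move=> n m nm; rewrite -!segF subsetEset; apply: image_subset.
    by have := ndcc _ _ nm; rewrite subsetEset.
  - by move=> n; apply/measurable_EFinP; apply: measurable_funS mG.
  - by move=> n x /subcd xcd; rewrite lee_fin G0.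
have h2 : (\int[lebesgue_measure]_(x in `[u n, v n]) (G (F x) * f x)%:E)%E
  @[n --> \oo] --> (\int[lebesgue_measure]_(x in `]a, b[) (G (F x) * f x)%:E)%E.
  rewrite -bcup; apply: ge0_nondecreasing_set_cvg_integral => //.
  - by move=> n; apply/measurable_EFinP; apply: measurable_funS mGF => // x /cc.
  - move=> n x /cc xab; rewrite lee_fin mulr_ge0 ?G0 ?Fcd//.
    by rewrite ltW// f0.
rewrite -(cvg_lim _ h1)// -(cvg_lim _ h2)//; congr (limn _).
apply/funext => n.
(* The compact rule asks for one-sided limits of the derivative at the ends. They exist because the
   ends are interior to []a, b[], where the derivative is the continuous [f]. *)
rewrite integration_by_substitution_increasing; last 7 first.
- exact: ltW.
- by move=> x y /cc xab /cc yab; exact: incrF.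
- move=> x xuv; have xab : x \in `]a, b[ by apply/(cc n)/subset_itv_oo_cc.
  rewrite /continuous_at F'E//; apply: cvg_trans (cf _ xab).
  apply: near_eq_cvg; near=> y; rewrite F'E//.
  by near: y; exact: near_in_itvoo.
- apply/cvg_ex; exists (f (u n)).
  have /cvg_at_right_filter := cf _ (uab n); apply: cvg_trans.
  apply: near_eq_cvg; near=> y; rewrite F'E//; apply: (cc n).
  by rewrite in_itv/=; apply/andP; split; near: y;
    [exact: nbhs_right_ge|exact: nbhs_right_le].
- apply/cvg_ex; exists (f (v n)).
  have /cvg_at_left_filter := cf _ (vab n); apply: cvg_trans.
  apply: near_eq_cvg; near=> y; rewrite F'E//; apply: (cc n).
  by rewrite in_itv/=; apply/andP; split; near: y;
    [exact: nbhs_left_ge|exact: nbhs_left_le].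
- split.
  + by move=> x xuv; apply/DF/(cc n)/subset_itv_oo_cc.
  + exact/cvg_at_right_filter/cF.
  + exact/cvg_at_left_filter/cF.
- by apply: continuous_in_subspaceT => x; rewrite inE => /subcd; exact: cG.
by apply: eq_integral => x; rewrite inE => /cc xab /=; rewrite fctE F'E.
Unshelve. all: by end_near. Qed.

(** * Continuity, images and integrals of real powers *)

Lemma continuous_powR_gt0 (R : realType) (a x : R) : 0 < x ->
  {for x, continuous (fun y : R => y `^ a)}.
Proof.
move=> x0; apply/differentiable_continuous/derivable1_diffP.
by apply: derivable_powR; rewrite in_itv/= x0.
Qed.

Lemma powR_lt1 (R : realType) (r x : R) : 0 < r -> 0 <= x -> x < 1 -> x `^ r < 1.
Proof.
move=> r0 x0 x1.
have := @gt0_ltr_powR R r r0 x 1; rewrite powR1; apply => //.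
  by rewrite nnegrE.
Qed.

Lemma onem_powR_gt0 (R : realType) (r x : R) : 0 < r -> 0 <= x -> x < 1 ->
  0 < 1 - x `^ r.
Proof. by move=> r0 x0 x1; rewrite subr_gt0 powR_lt1. Qed.

Lemma powR_image_oo (R : realType) (r y : R) : 0 < r -> 0 <= y ->
  (fun x : R => x `^ r) @` `]0, y[%classic = `]0, y `^ r[%classic.
Proof.
move=> r0 y0; apply/seteqP; split => [_ [x /= + <-]|z/=]; rewrite !in_itv/=.
  move=> /andP[x0 xy]; rewrite powR_gt0//=.
  by rewrite gt0_ltr_powR// nnegrE// ltW.
move=> /andP[z0 zy]; exists (z `^ r^-1); last first.
  by rewrite -powRrM mulVf ?gt_eqF// powRr1// ltW.
rewrite /= in_itv/= powR_gt0//=.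
have -> : y = (y `^ r) `^ r^-1 by rewrite -powRrM mulfV ?gt_eqF// powRr1.
by rewrite gt0_ltr_powR ?invr_gt0// nnegrE ?powR_ge0// ltW.
Qed.

(** The map is [x ^ r] conjugated by the involution [x -> 1 - x] of the unit interval. *)
Lemma onem_powR_image_oo (R : realType) (r : R) : 0 < r ->
  (fun x : R => 1 - (1 - x) `^ r) @` `]0, 1[%classic = `]0, 1[%classic.
Proof.
move=> r0; have := @powR_image_oo R r 1 r0 ler01; rewrite powR1 => im.
have flip (z : R) : `]0, 1[%classic z -> `]0, 1[%classic (1 - z).
  by rewrite /= !in_itv/=; lra.
apply/seteqP; split => [_ [x x01 <-]|z z01].
  by apply: (flip); rewrite -im; exists (1 - x) => //; exact: flip.
have [x x01 xz] : ((fun x : R => x `^ r) @` `]0, 1[%classic) (1 - z).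
  by rewrite im; exact: flip.
by exists (1 - x); [exact: flip|rewrite !subKr xz subKr].
Qed.

(** Substituting [x = v ^ r] with [r = 1 / (a + 1)] flattens the integrand to the constant [r],
    because [r * a + (r - 1) = 0]. This covers the singular range [-1 < a < 0] as well. *)
Lemma integral_powR (R : realType) (a y : R) : -1 < a -> 0 <= y ->
  (\int[lebesgue_measure]_(x in `]0%R, y[) (x `^ a)%:E =
   (y `^ (a + 1) / (a + 1))%:E)%E.
Proof.
move=> a1; rewrite le_eqVlt => /predU1P[<-|y0].
  by rewrite set_itvoo0 integral_set0 powR0 ?mul0r// lt0r_neq0//; lra.
have a10 : 0 < a + 1 by lra.
pose r := (a + 1)^-1; have r0 : 0 < r by rewrite invr_gt0.
have dF (x : R) : x \in `]0, y `^ (a + 1)[ ->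
    is_derive x 1 (fun v => v `^ r) (r * x `^ (r - 1)).
  by rewrite in_itv/= => /andP[x0 _]; exact: is_derive1_powR.
rewrite (@ge0_integration_by_substitution_oo R _ _ _ _ _ _ _ _ dF).
- transitivity (\int[lebesgue_measure]_(x in `]0%R, (y `^ (a + 1))%R[) cst r%:E x)%E.
    apply: eq_integral => x; rewrite inE/= in_itv/= => /andP[x0 _].
    congr EFin; rewrite mulrCA -powRrM -powRD ?(gt_eqF x0) ?implybT//.
    have -> : r * a + (r - 1) = 0.
      by rewrite addrA -[X in _ + X - _]mulr1 -mulrDr mulVf ?subrr ?gt_eqF.
    by rewrite powRr0 mulr1.
  rewrite integral_cst//= lebesgue_measure_itv/= lte_fin powR_gt0//.
  by rewrite oppr0 addr0 -EFinM mulrC.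
- exact: powR_gt0.
- move=> x; rewrite in_itv/= => /andP[x0 _]; apply: cvgM; first exact: cvg_cst.
  exact: continuous_powR_gt0.
- by move=> x; rewrite in_itv/= => /andP[x0 _]; rewrite mulr_gt0// powR_gt0.
- rewrite powR_image_oo ?powR_ge0// -powRrM mulfV ?gt_eqF// powRr1//.
  exact: ltW.
- by move=> x; rewrite in_itv/= => /andP[x0 _]; exact: continuous_powR_gt0.
- by move=> x _; exact: powR_ge0.
Qed.

Lemma is_derive_onem (R : realType) (x : R) : is_derive x 1 (fun x : R => 1 - x) (-1).
Proof.
have := @is_deriveB _ _ _ (cst (1 : R)) id x 1 _ _ (is_derive_cst _ _ _) (is_derive_id _ _).
by rewrite sub0r.
Qed.

Lemma continuous_onem (R : realType) : continuous (fun x : R => 1 - x).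
Proof. by move=> x; apply: cvgB; [exact: cvg_cst|exact: cvg_id]. Qed.

Lemma continuous_onem_powR (R : realType) (a x : R) : x < 1 ->
  {for x, continuous (fun y : R => (1 - y) `^ a)}.
Proof.
move=> x1; apply: (continuous_comp (f := fun x : R => 1 - x)
  (g := fun y : R => y `^ a)); first exact: continuous_onem.
by apply: continuous_powR_gt0; rewrite subr_gt0.
Qed.

(** The same flattening with [x = 1 - (1 - v) ^ r], reflected at both ends so that the substitution
    stays increasing. *)
Lemma integral_onem_powR (R : realType) (a : R) : -1 < a ->
  (\int[lebesgue_measure]_(x in `]0%R, 1%R[) ((1 - x) `^ a)%:E =
   (a + 1)^-1%:E)%E.
Proof.
move=> a1; have a10 : 0 < a + 1 by lra.
pose r := (a + 1)^-1; have r0 : 0 < r by rewrite invr_gt0.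
have dF (x : R) : x \in `]0, 1[ ->
    is_derive x 1 (fun v => 1 - (1 - v) `^ r) (r * (1 - x) `^ (r - 1)).
  rewrite in_itv/= => /andP[_ x1].
  have x0 : 0 < 1 - x by rewrite subr_gt0.
  have d1 := is_derive1_powR r x0.
  have d2 := @is_derive1_comp R _ _ x _ _ d1 (is_derive_onem R x).
  have := @is_deriveB _ _ _ (cst (1 : R)) _ x 1 _ _ (is_derive_cst _ _ _) d2.
  by rewrite sub0r mulrN1 opprK.
rewrite (@ge0_integration_by_substitution_oo R _ _ _ _ _ _ _ _ dF).
- transitivity (\int[lebesgue_measure]_(x in `]0%R, 1%R[) cst r%:E x)%E.
    apply: eq_integral => x; rewrite inE/= in_itv/= => /andP[_ x1].
    rewrite subKr; have {x1} : 0 < 1 - x by rewrite subr_gt0.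
    move: (1 - x) => {}x x0.
    congr EFin; rewrite mulrCA -powRrM -powRD ?(gt_eqF x0) ?implybT//.
    have -> : r * a + (r - 1) = 0.
      by rewrite addrA -[X in _ + X - _]mulr1 -mulrDr mulVf ?subrr ?gt_eqF.
    by rewrite powRr0 mulr1.
  rewrite integral_cst//= lebesgue_measure_itv/= lte_fin ltr01.
  by rewrite oppr0 addr0 -EFinM mulr1.
- exact: ltr01.
- move=> x; rewrite in_itv/= => /andP[_ x1]; apply: cvgM; first exact: cvg_cst.
  exact: continuous_onem_powR.
- move=> x; rewrite in_itv/= => /andP[_ x1]; rewrite mulr_gt0// powR_gt0//.
  by rewrite subr_gt0.
- exact: onem_powR_image_oo.
- move=> x; rewrite in_itv/= => /andP[_ x1].
  exact: continuous_onem_powR.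
- by move=> x _; exact: powR_ge0.
Qed.

(** * The integrand [s ^ k * (1 - s ^ q) ^ c] and the beta integral *)

Lemma continuous_powR_onem_powR (R : realType) (k q c x : R) :
  0 < q -> x \in `]0, 1[ ->
  {for x, continuous (fun s : R => s `^ k * (1 - s `^ q) `^ c)}.
Proof.
move=> q0; rewrite in_itv/= => /andP[x0 x1].
apply: cvgM; first exact: continuous_powR_gt0.
apply: (continuous_comp (f := fun s : R => s `^ q)
  (g := fun u : R => (1 - u) `^ c)); first exact: continuous_powR_gt0.
by apply: continuous_onem_powR; rewrite powR_lt1// ltW.
Qed.

Lemma measurable_powR_onem_powR (R : realType) (k q c y : R) :
  0 < q -> y <= 1 ->
  measurable_fun `]0, y[ (fun s : R => s `^ k * (1 - s `^ q) `^ c).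
Proof.
move=> q0 y1; apply: open_continuous_measurable_fun => //.
move=> x; rewrite inE/= in_itv/= => /andP[x0 xy].
by apply: continuous_powR_onem_powR => //; rewrite in_itv/= x0 (lt_le_trans xy).
Qed.

(* Multiplying the integrand by [t + (1 - t)] bounds it by the sum of two
   powers. *)
Lemma beta_EFin (R : realType) (a b : R) : 0 < a -> 0 < b ->
  (\int[lebesgue_measure]_(t in `]0%R, 1%R[)
     (t `^ (a - 1) * (1 - t) `^ (b - 1))%:E = (beta a b)%:E)%E.
Proof.
move=> a0 b0.
have cpow (c x : R) : x \in `]0%R, 1%R[%classic ->
    {for x, continuous (fun y : R => y `^ c)}.
  by rewrite inE/= in_itv/= => /andP[? _]; exact: continuous_powR_gt0.
have conem (c x : R) : x \in `]0%R, 1%R[%classic ->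
    {for x, continuous (fun y : R => (1 - y) `^ c)}.
  by rewrite inE/= in_itv/= => /andP[_ ?]; exact: continuous_onem_powR.
have mpow (c : R) : measurable_fun `](0 : R), 1[ (fun y : R => y `^ c).
  by apply: open_continuous_measurable_fun => // x; exact: cpow.
have monem (c : R) : measurable_fun `](0 : R), 1[ (fun y : R => (1 - y) `^ c).
  by apply: open_continuous_measurable_fun => // x; exact: conem.
have mf : measurable_fun `](0 : R), 1[
    (fun t : R => t `^ (a - 1) * (1 - t) `^ (b - 1)).
  exact: measurable_funM.
(* [beta] is [fine] of the extended integral, and [fine] sends an infinite value to 0; the equality
   therefore rests on finiteness. *)
rewrite /beta /Rintegral [in RHS]integral_itv_bndoo; last exact/measurable_EFinP.
rewrite [in RHS]fineK// ge0_fin_numE; last first.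
  by apply: integral_ge0 => x _; rewrite lee_fin mulr_ge0 ?powR_ge0.
apply: (@le_lt_trans _ _ (\int[lebesgue_measure]_(t in `]0%R, 1%R[)
  ((t `^ (a - 1))%:E + ((1 - t) `^ (b - 1))%:E))%E).
  apply: ge0_le_integral => //.
  - by move=> x _; rewrite lee_fin mulr_ge0 ?powR_ge0.
  - exact/measurable_EFinP.
  - by apply: emeasurable_funD; apply/measurable_EFinP; [exact: mpow|exact: monem].
  - move=> x; rewrite /= in_itv/= => /andP[x0 x1]; rewrite -EFinD lee_fin.
    have y0 : 0 < 1 - x by rewrite subr_gt0.
    have h1 : x * x `^ (a - 1) <= 1.
      by rewrite mulr_powRB1 ?(ltW x0)// ltW// powR_lt1// ltW.
    have h2 : (1 - x) * (1 - x) `^ (b - 1) <= 1.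
      by rewrite mulr_powRB1 ?(ltW y0)// ltW// powR_lt1 ?(ltW y0)//; lra.
    have := ler_wpM2r (powR_ge0 (1 - x) (b - 1)) h1.
    have := ler_wpM2r (powR_ge0 x (a - 1)) h2; lra.
rewrite ge0_integralD//=; first last.
  - by apply/measurable_EFinP; first [exact: mpow|exact: monem].
  - by move=> x _; rewrite lee_fin powR_ge0.
  - by apply/measurable_EFinP; first [exact: mpow|exact: monem].
  - by move=> x _; rewrite lee_fin powR_ge0.
rewrite integral_powR ?ler01 ?integral_onem_powR ?lte_add_pinfty ?ltry//; lra.
Qed.

(** Besides giving the complete integral, this finite value is the source of integrability for all
    integrands of this shape, the density of [arcsin_pq] included. *)
Lemma integral_powR_onem_powR_beta (R : realType) (k q b : R) :
  -1 < k -> 0 < q -> 0 < b ->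
  (\int[lebesgue_measure]_(s in `]0%R, 1%R[)
     (s `^ k * (1 - s `^ q) `^ (b - 1))%:E =
   (q^-1 * beta ((k + 1) / q) b)%:E)%E.
Proof.
move=> k1 q0 b0.
have k10 : 0 < k + 1 by lra.
have dF (x : R) : x \in `]0, 1[ ->
    is_derive x 1 (fun s => s `^ q) (q * x `^ (q - 1)).
  by rewrite in_itv/= => /andP[x0 _]; exact: is_derive1_powR.
rewrite EFinM -beta_EFin ?divr_gt0//.
rewrite [in RHS](@ge0_integration_by_substitution_oo R _ _ _ _ _ _ _ _ dF).
- rewrite -ge0_integralZl//=.
  + apply: eq_integral => x; rewrite inE/= in_itv/= => /andP[x0 x1].
    rewrite -EFinM; congr EFin.
    have -> : x `^ k = (x `^ q) `^ ((k + 1) / q - 1) * x `^ (q - 1).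
      rewrite -powRrM -powRD ?(gt_eqF x0) ?implybT//; congr (_ `^ _).
      by field; rewrite gt_eqF.
    by field; rewrite gt_eqF.
  + apply/measurable_EFinP; apply: open_continuous_measurable_fun => //.
    move=> x; rewrite inE/= in_itv/= => /andP[x0 x1].
    apply: cvgM; last first.
      by apply: cvgM; [exact: cvg_cst|exact: continuous_powR_gt0].
    apply: (continuous_comp (f := fun s : R => s `^ q)
      (g := fun u : R => u `^ _ * (1 - u) `^ _)).
      exact: continuous_powR_gt0.
    apply: cvgM; first by apply: continuous_powR_gt0; rewrite powR_gt0.
    by apply: continuous_onem_powR; rewrite powR_lt1// ltW.
  + move=> x; rewrite in_itv/= => /andP[x0 x1].
    by rewrite lee_fin !mulr_ge0 ?powR_ge0// ltW.
  + by rewrite lee_fin invr_ge0 ltW.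
- exact: ltr01.
- move=> x; rewrite in_itv/= => /andP[x0 _]; apply: cvgM; first exact: cvg_cst.
  exact: continuous_powR_gt0.
- by move=> x; rewrite in_itv/= => /andP[x0 _]; rewrite mulr_gt0// powR_gt0.
- by rewrite powR_image_oo// powR1.
- move=> x; rewrite in_itv/= => /andP[x0 x1].
  apply: cvgM; [exact: continuous_powR_gt0|exact: continuous_onem_powR].
- by move=> x _; rewrite mulr_ge0 ?powR_ge0.
Qed.

(** * The binomial series of [(1 - u) ^ (- b)] *)

(* The coefficient of [u ^ n] in the binomial series of [(1 - u) ^ (- b)]. *)
Definition binom_coef (R : realType) (b : R) (n : nat) : R :=
  pochhammer b n / n`!%:R.

Lemma pochhammerS (R : realType) (b : R) (n : nat) :
  pochhammer b n.+1 = pochhammer b n * (b + n%:R).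
Proof. by rewrite /pochhammer big_ord_recr. Qed.

Lemma binom_coef0 (R : realType) (b : R) : binom_coef R b 0 = 1.
Proof. by rewrite /binom_coef /pochhammer big_ord0 fact0 divr1. Qed.

Lemma binom_coefS (R : realType) (b : R) (n : nat) :
  n.+1%:R * binom_coef R b n.+1 = (b + n%:R) * binom_coef R b n.
Proof.
rewrite /binom_coef pochhammerS factS natrM.
by field; rewrite nat1r !pnatr_eq0 -lt0n fact_gt0.
Qed.

(** The ratio of consecutive coefficients is [(b + n) / (n + 1)], which lies between 0 and 1 for
    such [b] and [n]. *)
Lemma binom_coef_norm_nonincr (R : realType) (b : R) (n : nat) :
  b < 1 -> `|b| <= n%:R -> `|binom_coef R b n.+1| <= `|binom_coef R b n|.
Proof.
move=> b1 bn.
rewrite -(@ler_pM2l _ n.+1%:R)// -[X in X * _ <= _](@ger0_norm _ n.+1%:R)//.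
rewrite -normrM binom_coefS normrM ler_wpM2r//.
move: bn; rewrite -[n.+1]addn1 natrD !ler_norml; lra.
Qed.

Lemma binom_coef_norm_bounded (R : realType) (b : R) : b < 1 ->
  exists2 C : R, 0 <= C & \forall n \near \oo, `|binom_coef R b n| <= C.
Proof.
move=> b1; pose N := Num.bound `|b|.
exists `|binom_coef R b N| => //; exists N => // n /= Nn.
rewrite -(subnK Nn); elim: (n - N)%N => // m; apply: le_trans.
rewrite addSn; apply: binom_coef_norm_nonincr => //.
rewrite (le_trans (ltW (archi_boundP _)))// ler_nat leq_addl//.
Qed.

(** Once [n] exceeds [|b|], the ratio [(b + n) / (n + 1)] is nonnegative, so the sign at [N] is
    passed on. *)
Lemma binom_coef_eventually_signed (R : realType) (b : R) : exists N : nat,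
  (forall n, (N <= n)%N -> 0 <= binom_coef R b n) \/
  (forall n, (N <= n)%N -> binom_coef R b n <= 0).
Proof.
pose N := Num.bound `|b|; exists N.
have step n : (N <= n)%N ->
    exists2 t : R, 0 <= t & binom_coef R b n.+1 = t * binom_coef R b n.
  move=> Nn; exists ((b + n%:R) / n.+1%:R).
    rewrite divr_ge0//.
    have : `|b| <= n%:R.
      by rewrite (le_trans (ltW (archi_boundP _)))// ler_nat.
    by rewrite ler_norml; lra.
  by rewrite mulrAC -binom_coefS mulrC mulKf.
have [h|h] := leP 0 (binom_coef R b N); [left|right] => n Nn;
  rewrite -(subnK Nn); elim: (n - N)%N => [|m ih]; rewrite ?add0n ?(ltW h)//;
  rewrite addSn; have [t t0 ->] := step (m + N)%N (leq_addl _ _).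
  exact: mulr_ge0.
exact: mulr_ge0_le0.
Qed.

Definition binom_sum (R : realType) (b : R) (N : nat) (u : R) : R :=
  \sum_(0 <= n < N) binom_coef R b n * u ^+ n.

Lemma binom_sumS (R : realType) (b : R) (N : nat) (u : R) :
  binom_sum R b N.+1 u = binom_sum R b N u + binom_coef R b N * u ^+ N.
Proof. by rewrite /binom_sum big_nat_recr. Qed.

(* The partial sums solve [(1 - u) P' = b P] up to a single monomial. *)
Lemma is_derive_binom_sum (R : realType) (b : R) (N : nat) (u : R) :
  exists2 d : R, is_derive u 1 (binom_sum R b N) d &
    (1 - u) * d - b * binom_sum R b N u
      = - (N%:R * binom_coef R b N * u ^+ N.-1).
Proof.
elim: N => [|N [d dd dE]].
  exists 0; last by rewrite /binom_sum big_geq// !mulr0 subr0 !mul0r oppr0.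
  have -> : binom_sum R b 0 = cst 0 by apply/funext => v; rewrite /binom_sum big_geq.
  exact: is_derive_cst.
have -> : binom_sum R b N.+1 =
    (fun v => binom_sum R b N v + binom_coef R b N * v ^+ N).
  by apply/funext => v; rewrite binom_sumS.
exists (d + binom_coef R b N * (N%:R * u ^+ N.-1)).
  apply: is_deriveD.
  have dX : is_derive u 1 (fun v : R => v ^+ N) (N%:R * u ^+ N.-1).
    by split; [exact: exprn_derivable|rewrite exp_derive [_ *: 1]mulr1].
  exact: (is_deriveZ _ dX).
rewrite binom_coefS /= mulrDr.
(* For [N = 0] the truncated predecessor breaks [u * u ^ (N - 1) = u ^ N], but the factor [N] makes
   both sides vanish. *)
have -> : (1 - u) * (binom_coef R b N * (N%:R * u ^+ N.-1)) =
    N%:R * binom_coef R b N * u ^+ N.-1 - N%:R * binom_coef R b N * u ^+ N.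
  by case: N {d dd dE} => [|N]; rewrite ?mul0r ?mulr0 ?subrr// exprS /=; ring.
have -> : (1 - u) * d = b * binom_sum R b N u - N%:R * binom_coef R b N * u ^+ N.-1.
  by rewrite -[LHS](subrK (b * binom_sum R b N u)) dE addrC.
ring.
Qed.

Lemma continuous_binom_sum (R : realType) (b : R) (N : nat) :
  continuous (binom_sum R b N).
Proof.
move=> u; have [d [dP _] _] := @is_derive_binom_sum R b N u.
exact/differentiable_continuous/derivable1_diffP.
Qed.

(** [(1 - u) ^ b] is the integrating factor of [(1 - u) P' = b P]; only the leftover monomial
    survives in the derivative. *)
Lemma is_derive_binom_sumM (R : realType) (b : R) (N : nat) (u : R) : u < 1 ->
  is_derive u 1 (fun v : R => binom_sum R b N v * (1 - v) `^ b)
    (- (N%:R * binom_coef R b N * u ^+ N.-1) * (1 - u) `^ (b - 1)).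
Proof.
move=> u1; have v0 : 0 < 1 - u by rewrite subr_gt0.
have [d dP dE] := @is_derive_binom_sum R b N u.
have dQ := @is_derive1_comp R _ _ u _ _ (is_derive1_powR b v0) (is_derive_onem R u).
apply: (is_derive_eq (is_deriveM dP dQ)); rewrite -dE /= /GRing.scale/=.
have -> : (1 - u) `^ b = (1 - u) * (1 - u) `^ (b - 1).
  by rewrite -[X in X * _]powRr1 ?ltW// -powRD ?subrKC// (gt_eqF v0) implybT.
ring.
Qed.

(** With [r] the square root of [u], the term is the bounded [n * r ^ n] times [r ^ n], which tends
    to 0. *)
Lemma cvg_natM_exprn (R : realType) (u : R) : 0 <= u -> u < 1 ->
  (fun n : nat => n%:R * u ^+ n) @ \oo --> 0.
Proof.
move=> u0 u1; pose r := Num.sqrt u.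
have r0 : 0 <= r by exact: sqrtr_ge0.
have r1 : r < 1 by rewrite -[ltRHS]sqrtr1 ltr_sqrt.
(* [n r ^ n] is at most [1 + r + ... + r ^ (n - 1)]. *)
have h n : n%:R * r ^+ n <= (1 - r)^-1.
  rewrite -[leRHS]mul1r ler_pdivlMr ?subr_gt0//.
  have -> : n%:R * r ^+ n = \sum_(i < n) r ^+ n.
    by rewrite sumr_const card_ord mulr_natl.
  apply: (@le_trans _ _ ((\sum_(i < n) r ^+ i) * (1 - r))).
    rewrite ler_wpM2r ?subr_ge0 ?(ltW r1)//; apply: ler_sum => i _.
    by rewrite ler_wiXn2l ?(ltW r1) ?(ltnW (ltn_ord i)).
  rewrite mulrC -[1 - r]opprB mulNr -subrX1 opprB.
  by rewrite gerBl exprn_ge0.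
apply: (@squeeze_cvgr _ _ _ _ (cst 0) (fun n => (1 - r)^-1 * r ^+ n)).
- apply: nearW => n; rewrite mulr_ge0 ?exprn_ge0//=.
  rewrite -[u in u ^+ n]sqr_sqrtr// -exprM mul2n -addnn exprD mulrA.
  by rewrite ler_wpM2r ?exprn_ge0.
- exact: cvg_cst.
- by have := @cvg_geometric R (1 - r)^-1 r; rewrite ger0_norm//; apply.
Qed.

(** The product of the partial sum and [(1 - v) ^ b] equals 1 at [v = 0]. By the mean value theorem
    it differs from 1 at [u] by at most a multiple of [N * u ^ N], as the coefficients are bounded
    for [b < 1]. *)
Lemma cvg_binom_sum (R : realType) (b u : R) : b < 1 -> 0 <= u -> u < 1 ->
  (fun N => binom_sum R b N u) @ \oo --> (1 - u) `^ (- b).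
Proof.
move=> b1 u0 u1; have v0 : 0 < 1 - u by rewrite subr_gt0.
have [C C0 HC] := @binom_coef_norm_bounded R b b1.
pose M := (1 - u) `^ (b - 1).
(* For [N = 0] the sum is empty and its value at 0 is not 1. *)
have bound N : (0 < N)%N ->
    `|binom_sum R b N u * (1 - u) `^ b - 1|
      <= `|binom_coef R b N| * (N%:R * u ^+ N) * M.
  move=> N0; move: u0; rewrite le_eqVlt => /predU1P[<-|u0].
    rewrite subr0 powR1 mulr1 expr0n gtn_eqF// !mulr0 mul0r.
    rewrite /binom_sum -(prednK N0) big_nat_recl// expr0 mulr1 binom_coef0.
    by rewrite big1 ?addr0 ?subrr ?normr0// => i _; rewrite expr0n mulr0.
  have dF x : x \in `]0, u[ -> x < 1.
    by rewrite in_itv/= => /andP[_ xu]; lra.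
  have [|x] := MVT u0 (fun x xu => @is_derive_binom_sumM R b N x (dF x xu)).
    apply: continuous_in_subspaceT => x; rewrite inE/= in_itv/= => /andP[_ xu].
    have [|? _] := @is_derive_binom_sumM R b N x; first by lra.
    exact/differentiable_continuous/derivable1_diffP.
  rewrite in_itv/= => /andP[x0 xu].
  have -> : binom_sum R b N 0 = 1.
    rewrite /binom_sum -(prednK N0) big_nat_recl// expr0 mulr1 binom_coef0.
    by rewrite big1 ?addr0 // => i _; rewrite expr0n mulr0.
  rewrite !subr0 powR1 mulr1 => ->.
  move: (binom_coef R b N) => c.
  rewrite !normrM normrN !normrM normr_nat (ger0_norm (powR_ge0 _ _)).
  rewrite (ger0_norm (ltW u0)) (ger0_norm (exprn_ge0 _ (ltW x0))).
  have -> : `|c| * (N%:R * u ^+ N) * M =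
      (N%:R * `|c| * u ^+ N.-1 * M) * u.
    by rewrite -[in u ^+ N](prednK N0) exprS; ring.
  rewrite ler_wpM2r ?(ltW u0)// ler_pM ?mulr_ge0 ?exprn_ge0 ?powR_ge0 ?(ltW x0)//.
    rewrite ler_wpM2l ?mulr_ge0// lerXn2r ?nnegrE ?ltW//.
  (* The exponent [b - 1] is negative, so [(1 - x) ^ (b - 1)] grows with [x] and is largest at
     [u]. *)
  rewrite /M -[b - 1]opprB !powRN lef_pV2 ?posrE ?powR_gt0 ?subr_gt0//; last by lra.
  by rewrite ge0_ler_powR ?nnegrE; lra.
have lim0 : (fun N => C * (N%:R * u ^+ N) * M) @ \oo --> 0.
  suff : (fun N => C * (N%:R * u ^+ N) * M) @ \oo --> C * 0 * M.
    by rewrite mulr0 mul0r.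
  by apply: cvgMr_tmp; apply: cvgMl_tmp; exact: cvg_natM_exprn.
have lim1 : (fun N => binom_sum R b N u * (1 - u) `^ b) @ \oo --> (1 : R).
  apply/cvgrPdist_le => e e0.
  move/cvgrPdist_le : lim0 => /(_ e e0) lim0; near=> N.
  rewrite distrC (le_trans (bound N _))//; first by near: N; exists 1%N.
  rewrite (@le_trans _ _ (C * (N%:R * u ^+ N) * M))//.
    rewrite !ler_wpM2r ?powR_ge0 ?mulr_ge0 ?exprn_ge0//; near: N; exact: HC.
  rewrite (le_trans (ler_norm _))// -normrN -sub0r; near: N; exact: lim0.
have -> : (fun N => binom_sum R b N u) =
    (fun N => (binom_sum R b N u * (1 - u) `^ b) * (1 - u) `^ (- b)).
  by apply/funext => N; rewrite powRN mulfK// gt_eqF// powR_gt0.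
by rewrite -[(1 - u) `^ (- b) in X in _ --> X]mul1r; exact: cvgMr_tmp.
Unshelve. all: by end_near. Qed.

(* The coefficients eventually have a constant sign, so that late partial sums
   lie between a fixed partial sum and the limit. *)
Lemma binom_sum_dominated (R : realType) (b : R) : b < 1 ->
  exists (N0 : nat) (C : R), forall N u, (N0 <= N)%N ->
    0 <= u -> u < 1 -> `|binom_sum R b N u| <= C + (1 - u) `^ (- b).
Proof.
move=> b1; have [N0 sgn] := @binom_coef_eventually_signed R b.
exists N0; exists (\sum_(0 <= n < N0) `|binom_coef R b n|).
move=> N u N0N u0 u1.
have c0 : `|binom_sum R b N0 u| <= \sum_(0 <= n < N0) `|binom_coef R b n|.
  rewrite (le_trans (ler_norm_sum _ _ _))//; apply: ler_sum => n _.
  rewrite normrM ler_piMr// ger0_norm ?exprn_ge0// exprn_ile1//; exact: ltW.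
have P0 := powR_ge0 (1 - u) (- b).
have lim_shift : (fun n => binom_sum R b (n + N0)%N u) @ \oo --> (1 - u) `^ (- b).
  by rewrite (cvg_shiftn N0 (fun n => binom_sum R b n u)); exact: cvg_binom_sum.
have cv_shift := cvgP _ lim_shift.
(* With the power written as a limit, the partial sum at [N] lies between the one at [N0], bounded
   by [c0], and this limit, nonnegative by [P0]. *)
rewrite -(cvg_lim _ lim_shift)// in P0 *.
case: sgn => sgn.
- have nd : nondecreasing_seq (fun n => binom_sum R b (n + N0)%N u).
    apply/nondecreasing_seqP => n; rewrite addSn binom_sumS lerDl.
    by rewrite mulr_ge0 ?exprn_ge0// sgn ?leq_addl.
  have := nondecreasing_cvgn_le nd cv_shift (N - N0)%N.
  have := nd 0%N (N - N0)%N (leq0n _).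
  rewrite add0n subnK//; move: c0; rewrite !ler_norml; lra.
- have ni : nonincreasing_seq (fun n => binom_sum R b (n + N0)%N u).
    apply/nonincreasing_seqP => n; rewrite addSn binom_sumS gerDl.
    by rewrite mulr_le0_ge0 ?exprn_ge0// sgn ?leq_addl.
  have := nonincreasing_cvgn_ge ni cv_shift (N - N0)%N.
  have := ni 0%N (N - N0)%N (leq0n _).
  rewrite add0n subnK//; move: c0; rewrite !ler_norml; lra.
Qed.

(** * Termwise integration and the hypergeometric series *)

Lemma ge0_integrable_EFin d (T : measurableType d) (R : realType)
    (mu : {measure set T -> \bar R}) (D : set T) (f : T -> R) (r : R) :
  measurable D -> measurable_fun D f -> (forall x, D x -> 0 <= f x) ->
  (\int[mu]_(x in D) (f x)%:E = r%:E)%E ->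
  mu.-integrable D (fun x => (f x)%:E).
Proof.
move=> mD mf f0 fr; apply/integrableP; split; first exact/measurable_EFinP.
rewrite (eq_integral (fun x => (f x)%:E)) ?fr ?ltry// => x.
by rewrite inE => /f0 fx; rewrite gee0_abs ?lee_fin.
Qed.

Lemma integrable_powR (R : realType) (k y : R) : -1 < k -> 0 <= y ->
  lebesgue_measure.-integrable `]0, y[ (fun s : R => (s `^ k)%:E).
Proof.
move=> k1 y0; apply: (ge0_integrable_EFin _ _ _ _ _ _ _ _ _ _
  (integral_powR R k y k1 y0)) => //.
  apply: open_continuous_measurable_fun => // x.
  by rewrite inE/= in_itv/= => /andP[? _]; exact: continuous_powR_gt0.
by move=> x _; exact: powR_ge0.
Qed.

Lemma integrable_powR_onem_powR (R : realType) (k q b y : R) :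
  -1 < k -> 0 < q -> 0 < b -> y <= 1 ->
  lebesgue_measure.-integrable `]0, y[
    (fun s : R => (s `^ k * (1 - s `^ q) `^ (b - 1))%:E).
Proof.
move=> k1 q0 b0 y1.
have i1 : lebesgue_measure.-integrable `](0 : R), 1[
    (fun s : R => (s `^ k * (1 - s `^ q) `^ (b - 1))%:E).
  apply: (ge0_integrable_EFin _ _ _ _ _ _ _ _ _ _
    (integral_powR_onem_powR_beta R k q b k1 q0 b0)) => //.
    exact: measurable_powR_onem_powR.
  by move=> x _; rewrite mulr_ge0 ?powR_ge0.
by apply: integrableS i1 => //; apply: subset_itvl; rewrite bnd_simp.
Qed.

Lemma integral_powR_binom_sum (R : realType) (k q b y : R) (N : nat) :
  -1 < k -> 0 < q -> 0 <= y ->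
  (\int[lebesgue_measure]_(s in `]0%R, y[)
     (s `^ k * binom_sum R b N (s `^ q))%:E =
   (\sum_(0 <= n < N) binom_coef R b n *
     (y `^ (k + q * n%:R + 1) / (k + q * n%:R + 1)))%:E)%E.
Proof.
move=> k1 q0 y0.
have kq n : -1 < k + q * n%:R.
  by rewrite (lt_le_trans k1)// lerDl mulr_ge0// ltW.
transitivity (\int[lebesgue_measure]_(s in `]0%R, y[)
  (\sum_(0 <= n < N) ((binom_coef R b n)%:E * (s `^ (k + q * n%:R))%:E)))%E.
  apply: eq_integral => s; rewrite inE/= in_itv/= => /andP[s0 _].
  rewrite /binom_sum mulr_sumr -sumEFin; apply: eq_bigr => n _.
  rewrite -EFinM; congr EFin.
  rewrite powRD ?(gt_eqF s0) ?implybT// powRrM powR_mulrn ?powR_ge0//.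
  by rewrite mulrCA.
rewrite integral_sum//=; last first.
  by move=> n; apply: integrableZl => //; exact: integrable_powR.
rewrite -sumEFin; apply: eq_bigr => n _.
rewrite integralZl//; last exact: integrable_powR.
by rewrite integral_powR// EFinM.
Qed.

(** The existential form delivers finiteness of the integral together with convergence of the
    series, so that the [limn] in [hypergeo] can be evaluated, also at [y = 1]. *)
Lemma integral_powR_onem_powR_series (R : realType) (k q b y : R) :
  -1 < k -> 0 < q -> b < 1 -> 0 <= y -> y <= 1 ->
  exists2 I : R,
    (\int[lebesgue_measure]_(s in `]0%R, y[)
       (s `^ k * (1 - s `^ q) `^ (- b))%:E = I%:E)%E &
    series (fun n => binom_coef R b n *
      (y `^ (k + q * n%:R + 1) / (k + q * n%:R + 1))) @ \oo --> I.
Proof.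
move=> k1 q0 b1 y0 y1.
have [N0 [C dom]] := @binom_sum_dominated R b b1.
have iG : lebesgue_measure.-integrable `]0, y[
    (fun s : R => (s `^ k * (1 - s `^ q) `^ (- b))%:E).
  have := @integrable_powR_onem_powR R k q (1 - b) y k1 q0 _ y1.
  by rewrite addrAC subrr sub0r subr_gt0; exact.
(* This is [s ^ k] times the bound [C + (1 - u) ^ (- b)] at [u = s ^ q]. *)
pose g := fun s : R => (C%:E * (s `^ k)%:E + (s `^ k * (1 - s `^ q) `^ (- b))%:E)%E.
have ig : lebesgue_measure.-integrable `]0, y[ g.
  apply: integrableD => //.
  by apply: integrableZl => //; exact: integrable_powR.
have sq s : s \in `]0, y[ -> 0 < s /\ s `^ q < 1.
  rewrite in_itv/= => /andP[s0 sy]; split => //.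
  by rewrite powR_lt1 ?(ltW s0)// (lt_le_trans sy).
(* The index is shifted by [N0] because the domination only holds from there on; [cvg_shiftn] undoes
   the shift at the end. *)
have [] := @dominated_convergence _ _ R lebesgue_measure `]0, y[ _
  (fun N s => (s `^ k * binom_sum R b (N + N0)%N (s `^ q))%:E)
  (fun s => (s `^ k * (1 - s `^ q) `^ (- b))%:E) g.
- by [].
- move=> N; apply/measurable_EFinP; apply: open_continuous_measurable_fun => //.
  move=> x; rewrite inE/= in_itv/= => /andP[x0 xy].
  apply: cvgM; first exact: continuous_powR_gt0.
  apply: (continuous_comp (f := fun s : R => s `^ q)
    (g := fun u : R => binom_sum R b (N + N0)%N u)).
    exact: continuous_powR_gt0.
  exact: continuous_binom_sum.
- by apply/measurable_EFinP; exact: measurable_powR_onem_powR.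
- apply: aeW => s /= /sq[s0 sq1]; apply: cvg_EFin; first exact: nearW.
  apply: cvgMl_tmp.
  rewrite (cvg_shiftn N0 (fun n => binom_sum R b n (s `^ q))).
  by apply: cvg_binom_sum => //; exact: powR_ge0.
- exact: ig.
- apply: aeW => s N /= /sq[s0 sq1].
  rewrite /g -EFinM -EFinD lee_fin normrM (ger0_norm (powR_ge0 _ _)).
  rewrite [C * _]mulrC -mulrDr ler_wpM2l ?powR_ge0//.
  by apply: dom; rewrite ?leq_addl ?powR_ge0.
move=> _ _ lim.
have fin := integrable_fin_num _ iG.
exists (fine (\int[lebesgue_measure]_(s in `]0%R, y[)
       (s `^ k * (1 - s `^ q) `^ (- b))%:E)%E); first by rewrite fineK// fin.
rewrite -(cvg_shiftn N0); move: lim.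
rewrite -[X in _ --> X -> _]fineK ?fin// => /fine_cvg; apply: cvg_trans.
apply: near_eq_cvg; apply: nearW => N /=.
by rewrite integral_powR_binom_sum.
Qed.

Lemma pochhammer_gt0 (R : realType) (a : R) (n : nat) :
  0 < a -> 0 < pochhammer a n.
Proof.
by move=> a0; apply: prodr_gt0 => i _; rewrite (lt_le_trans a0)// lerDl.
Qed.

(** Both sides are the product of [a], [a + 1], up to [a + n]. *)
Lemma pochhammer_shift (R : realType) (a : R) (n : nat) :
  pochhammer a n * (a + n%:R) = a * pochhammer (1 + a) n.
Proof.
elim: n => [|n ih]; first by rewrite /pochhammer !big_ord0 addr0 mul1r mulr1.
rewrite pochhammerS ih pochhammerS -nat1r; ring.
Qed.

(** For [a = (k + 1) / q] this is [(k + 1) / (k + q * n + 1)], the factor that arises from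
    integrating [s ^ (k + q * n)]. *)
Lemma pochhammer_ratio (R : realType) (a : R) (n : nat) : 0 < a ->
  pochhammer a n / pochhammer (1 + a) n = a / (a + n%:R).
Proof.
move=> a0; have an : 0 < a + n%:R by rewrite (lt_le_trans a0)// lerDl.
have p0 : 0 < pochhammer (1 + a) n by apply: pochhammer_gt0; lra.
apply/eqP; rewrite eqr_div ?(gt_eqF an) ?(gt_eqF p0)//.
by rewrite pochhammer_shift.
Qed.

Lemma integral_powR_onem_powR_hypergeo (R : realType) (k q b y : R) :
  -1 < k -> 0 < q -> b < 1 -> 0 <= y -> y <= 1 ->
  (\int[lebesgue_measure]_(s in `]0%R, y[)
     (s `^ k * (1 - s `^ q) `^ (- b))%:E =
   ((k + 1)^-1 * y `^ (k + 1) *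
      hypergeo ((k + 1) / q) b (1 + (k + 1) / q) (y `^ q))%:E)%E.
Proof.
(* At [y = 0] both sides vanish; otherwise the prefactor [c] below is nonzero and can be divided out
   of the series term by term. *)
move=> k1 q0 b1; rewrite le_eqVlt => /predU1P[<- _|y0 y1].
  by rewrite set_itvoo0 integral_set0 powR0 ?mulr0 ?mul0r// lt0r_neq0//; lra.
have k10 : 0 < k + 1 by lra.
have [I -> lim] := @integral_powR_onem_powR_series R k q b y k1 q0 b1 (ltW y0) y1.
congr EFin; rewrite /hypergeo.
set c := (k + 1)^-1 * y `^ (k + 1).
have c0 : c != 0 by rewrite mulf_neq0 ?gt_eqF ?invr_gt0// powR_gt0.
rewrite -[LHS](mulVKf c0); congr (_ * _); apply/esym/cvg_lim => //.
have := cvgMl_tmp (a := c^-1) lim => /(_ _).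
apply: cvg_trans.
apply: near_eq_cvg; apply: nearW => N /=.
rewrite /series/= mulr_sumr; apply: eq_bigr => n _.
rewrite [pochhammer _ n * _ / _]mulrAC pochhammer_ratio ?divr_gt0//.
have -> : y `^ (k + q * n%:R + 1) = y `^ (k + 1) * (y `^ q) ^+ n.
  rewrite addrAC [LHS]powRD ?(gt_eqF y0) ?implybT//.
  by rewrite powRrM powR_mulrn// powR_ge0.
have yk : y `^ (k + 1) != 0 by rewrite gt_eqF// powR_gt0.
have kq : k + q * n%:R + 1 != 0.
  by rewrite gt_eqF// addrAC ltr_pwDl// mulr_ge0// ltW.
rewrite /c /binom_coef; field.
rewrite pnatr_eq0 -lt0n fact_gt0 (gt_eqF q0) (gt_eqF k10) yk /= andbT.
by rewrite [n%:R * q]mulrC addrAC.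
Qed.

(** * Regularity and monotonicity of [arcsin_pq] *)

Definition arcsin_density (R : realType) (p q t : R) : R :=
  ((1 - t `^ q) `^ p^-1)^-1.

(** This exhibits the density as the case [k = 0], [b = 1 - 1 / p] of the beta integrand; [b] is
    positive when [p > 1]. *)
Lemma arcsin_densityE (R : realType) (p q t : R) :
  arcsin_density R p q t = t `^ 0 * (1 - t `^ q) `^ (1 - p^-1 - 1).
Proof. by rewrite powRr0 mul1r addrAC subrr sub0r powRN. Qed.

Lemma measurable_arcsin_density (R : realType) (p q : R) (A : set R) :
  measurable_fun A (arcsin_density R p q).
Proof.
apply: (@measurable_funTS _ _ _ _ A).
have -> : arcsin_density R p q = fun t => (1 - t `^ q) `^ (- p^-1).
  by apply/funext => t; rewrite /arcsin_density powRN.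
apply: (measurableT_comp (measurable_powR _)).
by apply: measurable_funB => //; exact: measurable_powR.
Qed.

Lemma integrable_arcsin_density (R : realType) (p q : R) : 1 < p -> 1 < q ->
  lebesgue_measure.-integrable `[0, 1] (EFin \o arcsin_density R p q).
Proof.
move=> p1 q1; have q0 : 0 < q by lra.
have b0 : 0 < 1 - p^-1 by rewrite subr_gt0 invf_lt1//; lra.
have h := @integral_powR_onem_powR_beta R 0 q (1 - p^-1) (ltrN10 R) q0 b0.
apply: (ge0_integrable_EFin _ _ _ _ _ _
  (q^-1 * beta ((0 + 1) / q) (1 - p^-1))) => //.
- exact: measurable_arcsin_density.
- by move=> x _; rewrite invr_ge0 powR_ge0.
rewrite integral_itv_bndoo; last first.
  by apply/measurable_EFinP; exact: measurable_arcsin_density.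
by rewrite -h; apply: eq_integral => t _; rewrite arcsin_densityE.
Qed.

Lemma continuous_arcsin_density (R : realType) (p q t : R) :
  0 < q -> t \in `]0, 1[ -> {for t, continuous (arcsin_density R p q)}.
Proof.
move=> q0 t01.
have -> : arcsin_density R p q =
    (fun t => t `^ 0 * (1 - t `^ q) `^ (1 - p^-1 - 1)).
  by apply/funext => s; exact: arcsin_densityE.
exact: continuous_powR_onem_powR.
Qed.

Lemma arcsin_density_gt0 (R : realType) (p q t : R) :
  0 < q -> t \in `]0, 1[ -> 0 < arcsin_density R p q t.
Proof.
move=> q0; rewrite in_itv/= => /andP[t0 t1].
by rewrite invr_gt0 powR_gt0// onem_powR_gt0// ltW.
Qed.

Lemma is_derive_arcsin_pq (R : realType) (p q x : R) : 1 < p -> 1 < q ->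
  x \in `]0, 1[ -> is_derive x 1 (arcsin_pq p q) (arcsin_density R p q x).
Proof.
move=> p1 q1 x01; move: (x01); rewrite in_itv/= => /andP[x0 x1].
have q0 : 0 < q by lra.
have [dF F'E] := continuous_FTC1_closed x1 (integrable_arcsin_density R p q p1 q1)
  x0 (continuous_arcsin_density R p q x q0 x01).
by apply: DeriveDef; [exact: dF|rewrite -derive1E; exact: F'E].
Qed.

Lemma continuous_arcsin_pq (R : realType) (p q : R) : 1 < p -> 1 < q ->
  {within `[0, 1], continuous (@arcsin_pq R p q)}.
Proof.
move=> p1 q1; apply: parameterized_integral_continuous => //.
exact: integrable_arcsin_density.
Qed.

Lemma lt_arcsin_pq (R : realType) (p q : R) : 1 < p -> 1 < q ->
  {in `[0, 1] &, {homo @arcsin_pq R p q : x y / x < y}}.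
Proof.
move=> p1 q1; have q0 : 0 < q by lra.
apply: gtr0_derive1_lt_cc.
- by move=> x /(is_derive_arcsin_pq R p q x p1 q1)[].
- move=> x x01; have h := is_derive_arcsin_pq R p q x p1 q1 x01.
  by rewrite derive1E derive_val arcsin_density_gt0.
- exact: continuous_arcsin_pq.
Qed.

Lemma arcsin_pq0 (R : realType) (p q : R) : arcsin_pq p q 0 = 0 :> R.
Proof. by rewrite /arcsin_pq set_itv1 Rintegral_set1. Qed.

(** * The inverse function [sin_pq] and its derivative [cos_pq] *)

Lemma pi_pq_half (R : realType) (p q : R) : pi_pq p q / 2 = arcsin_pq p q 1.
Proof. by rewrite /pi_pq mulrC mulKf. Qed.

(** By the intermediate value theorem for [arcsin_pq] on [[0, 1]], the set in the definition of
    [sin_pq] is nonempty, so [get] returns one of its elements. *)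
Lemma sin_pqP (R : realType) (p q y : R) : 1 < p -> 1 < q ->
  0 <= y <= pi_pq p q / 2 ->
  0 <= sin_pq p q y <= 1 /\ arcsin_pq p q (sin_pq p q y) = y.
Proof.
move=> p1 q1; rewrite pi_pq_half => y01.
rewrite /sin_pq; apply: (@getPex _ [set x | 0 <= x <= 1 /\ arcsin_pq p q x = y]).
have [|x] := IVT ler01 (continuous_arcsin_pq R p q p1 q1) (v := y).
  have h : @arcsin_pq R p q 0 < arcsin_pq p q 1.
    by apply: lt_arcsin_pq => //; rewrite in_itv/= lexx ler01.
  by rewrite min_l ?max_r ?(ltW h)// arcsin_pq0.
by rewrite in_itv/= => x01 xy; exists x.
Qed.

Lemma le_arcsin_pq (R : realType) (p q : R) : 1 < p -> 1 < q ->
  {in `[0, 1] &, {mono @arcsin_pq R p q : x y / x <= y}}.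
Proof. by move=> p1 q1; exact/le_mono_in/lt_arcsin_pq. Qed.

Lemma arcsin_pqK (R : realType) (p q x : R) : 1 < p -> 1 < q -> 0 <= x <= 1 ->
  sin_pq p q (arcsin_pq p q x) = x.
Proof.
move=> p1 q1 x01; have le := le_arcsin_pq R p q p1 q1.
have [|s01 sE] := @sin_pqP R p q (arcsin_pq p q x) p1 q1.
  by rewrite pi_pq_half -(arcsin_pq0 R p q) !le ?in_itv/= ?lexx ?ler01.
exact: (inc_inj_in le).
Qed.

Lemma sin_pq_oo (R : realType) (p q y : R) : 1 < p -> 1 < q ->
  y \in `]0, pi_pq p q / 2[ -> sin_pq p q y \in `]0, 1[.
Proof.
move=> p1 q1; rewrite in_itv/= => /andP[y0 y1].
have [|s01 sE] := @sin_pqP R p q y p1 q1; first by rewrite !ltW.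
have lt := leW_mono_in (le_arcsin_pq R p q p1 q1).
rewrite in_itv/=; apply/andP; split; rewrite -lt ?in_itv/= ?lexx ?ler01// sE.
  by rewrite arcsin_pq0.
by rewrite -pi_pq_half.
Qed.

Lemma is_derive_sin_pq (R : realType) (p q y : R) : 1 < p -> 1 < q ->
  y \in `]0, pi_pq p q / 2[ ->
  is_derive y 1 (sin_pq p q) ((1 - sin_pq p q y `^ q) `^ p^-1).
Proof.
move=> p1 q1 y0; have q0 : 0 < q by lra.
have s01 := sin_pq_oo R p q y p1 q1 y0.
have sE : arcsin_pq p q (sin_pq p q y) = y.
  by apply: (sin_pqP _ _ _ _ _ _ _).2 => //; move: y0; rewrite in_itv/=; lra.
(* The base point becomes a value of [arcsin_pq] and the derivative the inverse of the density, as
   the inverse function rule requires. *)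
rewrite -[in is_derive y]sE -[X in is_derive _ _ _ X]invrK.
apply: is_derive_inverse.
- near=> x; apply: arcsin_pqK => //.
  have : x \in `]0, 1[ by near: x; exact: near_in_itvoo.
  by rewrite in_itv/=; lra.
- near=> x; apply/differentiable_continuous/derivable1_diffP.
  have : x \in `]0, 1[ by near: x; exact: near_in_itvoo.
  by move=> /(is_derive_arcsin_pq R p q x p1 q1)[].
- exact: is_derive_arcsin_pq.
- by rewrite gt_eqF// arcsin_density_gt0.
Unshelve. all: by end_near. Qed.

(** Near an interior point the limit within the closed interval is the ordinary punctured one, and
    the Caratheodory form of differentiability writes the difference quotient as a function
    continuous at [y]. *)
Lemma cos_pqE (R : realType) (p q y : R) : 1 < p -> 1 < q ->
  y \in `]0, pi_pq p q / 2[ ->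
  cos_pq p q y = (1 - sin_pq p q y `^ q) `^ p^-1.
Proof.
move=> p1 q1 y0.
have /is_derive1_caratheodory[g [gE gc <-]] := is_derive_sin_pq R p q y p1 q1 y0.
rewrite /cos_pq.
have -> : within `[0, pi_pq p q / 2] y^' = y^'.
  have nD : \forall z \near y^', `[0, pi_pq p q / 2]%classic z.
    apply: nbhs_dnbhs; near=> z; apply: subset_itv_oo_cc.
    by near: z; exact: (near_in_itvoo y0).
  apply/funext => P; apply/propext; split => [h|]; last by apply: filterS.
  near=> z; have : `[0, pi_pq p q / 2]%classic z by near: z.
  by near: z; exact: h.
apply/cvg_lim => //.
have : g z @[z --> y^'] --> g y by apply: cvg_within_filter.
apply: cvg_trans; apply: near_eq_cvg; near=> z.
rewrite gE mulfK// subr_eq0.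
by near: z; exact: nbhs_dnbhs_neq.
Unshelve. all: by end_near. Qed.

Lemma lt_sin_pq (R : realType) (p q : R) : 1 < p -> 1 < q ->
  {in `[0, pi_pq p q / 2] &, {homo @sin_pq R p q : x y / x < y}}.
Proof.
move=> p1 q1 x y; rewrite !in_itv/= => x01 y01 xy.
have [sx xE] := sin_pqP R p q x p1 q1 x01.
have [sy yE] := sin_pqP R p q y p1 q1 y01.
by rewrite -(leW_mono_in (le_arcsin_pq R p q p1 q1)) ?in_itv// xE yE.
Qed.

Lemma sin_pq0 (R : realType) (p q : R) : 1 < p -> 1 < q -> sin_pq p q 0 = 0 :> R.
Proof.
by move=> p1 q1; rewrite -{1}(arcsin_pq0 R p q) arcsin_pqK// lexx ler01.
Qed.

Lemma sin_pq_pi_half (R : realType) (p q : R) : 1 < p -> 1 < q ->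
  sin_pq p q (pi_pq p q / 2) = 1 :> R.
Proof. by move=> p1 q1; rewrite pi_pq_half arcsin_pqK// lexx ler01. Qed.

Lemma pi_pq_half_gt0 (R : realType) (p q : R) : 1 < p -> 1 < q ->
  0 < pi_pq p q / 2 :> R.
Proof.
move=> p1 q1; rewrite pi_pq_half -(arcsin_pq0 R p q).
by apply: lt_arcsin_pq => //; rewrite in_itv/= lexx ler01.
Qed.

Lemma sin_pq_image_oo (R : realType) (p q x : R) : 1 < p -> 1 < q ->
  0 <= x <= pi_pq p q / 2 ->
  @sin_pq R p q @` `]0, x[%classic = `]0, sin_pq p q x[%classic.
Proof.
move=> p1 q1 x01; have lt := lt_sin_pq R p q p1 q1.
have [sx xE] := sin_pqP R p q x p1 q1 x01.
apply/seteqP; split => [_ [y /= + <-]|s/=]; rewrite !in_itv/=.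
  move=> /andP[y0 yx]; apply/andP; split.
    by rewrite -[ltLHS](sin_pq0 R p q p1 q1) lt// in_itv/=; lra.
  by rewrite lt// in_itv/=; lra.
move=> /andP[s0 ss]; have s01 : 0 <= s <= 1 by lra.
exists (arcsin_pq p q s); last exact: arcsin_pqK.
rewrite /= in_itv/= -[in X in X && _](arcsin_pq0 R p q) -xE.
by rewrite !lt_arcsin_pq// in_itv/=; lra.
Qed.

(** * The substitution [s = sin_pq t] and the two formulas *)

(** One factor [cos_pq] is absorbed by the differential of [sin_pq]; the remaining power [l - 1] of
    [cos_pq] is [(1 - s ^ q) ^ ((l - 1) / p)]. *)
Lemma integral_sin_cos_pq (R : realType) (p q k l x : R) : 1 < p -> 1 < q ->
  0 <= x <= pi_pq p q / 2 ->
  (\int[lebesgue_measure]_(t in `[0%R, x])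
      (sin_pq p q t `^ k * cos_pq p q t `^ l)%:E =
   \int[lebesgue_measure]_(s in `]0%R, (sin_pq p q x)%R[)
      (s `^ k * (1 - s `^ q) `^ ((l - 1) / p))%:E)%E.
Proof.
move=> p1 q1 /[dup] x01 /andP[+ xpi].
have q0 : 0 < q by lra.
rewrite le_eqVlt => /predU1P[<-|x0].
  by rewrite sin_pq0// set_itv1 set_itvoo0 integral_set1 integral_set0.
pose f t := (1 - sin_pq p q t `^ q) `^ p^-1.
pose G s := s `^ k * (1 - s `^ q) `^ ((l - 1) / p).
have sub t : t \in `]0, x[ -> t \in `]0, pi_pq p q / 2[.
  by rewrite !in_itv/=; lra.
have s01 t : t \in `]0, x[ -> sin_pq p q t \in `]0, 1[.
  by move=> /sub; exact: sin_pq_oo.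
have f0 t : t \in `]0, x[ -> 0 < f t.
  move=> /s01; rewrite in_itv/= => /andP[t0 t1].
  by rewrite powR_gt0// onem_powR_gt0// ltW.
have dF t : t \in `]0, x[ -> is_derive t 1 (sin_pq p q) (f t).
  by move=> /sub; exact: is_derive_sin_pq.
have csin t : t \in `]0, x[ -> {for t, continuous (sin_pq p q)}.
  by move=> /dF[? _]; exact/differentiable_continuous/derivable1_diffP.
have cf t : t \in `]0, x[ -> {for t, continuous f}.
  move=> tx; have := s01 _ tx; rewrite in_itv/= => /andP[t0 t1].
  apply: (continuous_comp (f := sin_pq p q)
    (g := fun s : R => (1 - s `^ q) `^ p^-1)); first exact: csin.
  apply: (continuous_comp (f := fun s : R => s `^ q)
    (g := fun u : R => (1 - u) `^ p^-1)); first exact: continuous_powR_gt0.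
  by apply: continuous_onem_powR; rewrite powR_lt1// ltW.
have cG s : s \in `]0, 1[ -> {for s, continuous G}.
  exact: continuous_powR_onem_powR.
have GfE t : t \in `]0, x[ ->
    G (sin_pq p q t) * f t = sin_pq p q t `^ k * cos_pq p q t `^ l.
  move=> tx; rewrite (cos_pqE R p q t p1 q1 (sub _ tx)) /G /f.
  have := s01 _ tx; rewrite in_itv/= => /andP[t0 t1].
  have v0 : 0 < 1 - sin_pq p q t `^ q by rewrite onem_powR_gt0// ltW.
  rewrite -mulrA -powRD ?(gt_eqF v0) ?implybT// -powRrM.
  by congr (_ * (_ `^ _)); ring.
have sx1 : sin_pq p q x <= 1 by have [/andP[]] := sin_pqP R p q x p1 q1 x01.
have mGf : measurable_fun `]0, x[
    (fun t => sin_pq p q t `^ k * cos_pq p q t `^ l).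
  apply: (eq_measurable_fun (fun t => G (sin_pq p q t) * f t)).
    by move=> t; rewrite inE/= => /GfE.
  apply: open_continuous_measurable_fun => // t; rewrite inE/= => tx.
  apply: cvgM; last exact: cf.
  apply: (continuous_comp (f := sin_pq p q) (g := G)); first exact: csin.
  exact/cG/s01.
(* Dropping the two endpoints, a null set, leaves only points where [cos_pqE] applies. *)
rewrite integral_itv_bndoo; last exact/measurable_EFinP.
rewrite [RHS](@ge0_integration_by_substitution_oo R _ _ _ _ _ _ _ x0 dF).
- by apply: eq_integral => t; rewrite inE/= => /GfE <-.
- exact: cf.
- exact: f0.
- exact: sin_pq_image_oo.
- move=> s; rewrite in_itv/= => /andP[s0 s1]; apply: cG.
  by rewrite in_itv/= s0 (lt_le_trans s1).
- by move=> s _; rewrite mulr_ge0 ?powR_ge0.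
Qed.

Theorem theorem3p1 (R : realType) (p q : R) (hp : 1 < p) (hq : 1 < q)
    (k l : R) (hk : -1 < k) (hl : 1 - p < l) :
  (forall x : R, 0 <= x <= pi_pq p q / 2 ->
    (\int[lebesgue_measure]_(t in `[0%R, x])
        (sin_pq p q t `^ k * cos_pq p q t `^ l)%:E)%E
    = ((k + 1)^-1 * sin_pq p q x `^ (k + 1)
       * hypergeo ((k + 1) / q) ((1 - l) / p) (1 + (k + 1) / q)
                  (sin_pq p q x `^ q))%:E)
  /\
  (\int[lebesgue_measure]_(t in `[0%R, (pi_pq p q / 2)%R])
      (sin_pq p q t `^ k * cos_pq p q t `^ l)%:E)%E
  = (q^-1 * beta ((k + 1) / q) (1 + (l - 1) / p))%:E.
Proof.
have p0 : 0 < p by lra.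
have q0 : 0 < q by lra.
(* The hypothesis [1 - p < l] is exactly the bound [b < 1] of the binomial estimates, and the
   positivity of the second beta argument. *)
have b1 : (1 - l) / p < 1 by rewrite ltr_pdivrMr//; lra.
have bE : (l - 1) / p = - ((1 - l) / p) by rewrite -mulNr opprB.
split=> [x x01|].
  rewrite integral_sin_cos_pq// bE integral_powR_onem_powR_hypergeo//.
  - by have [/andP[]] := sin_pqP R p q x hp hq x01.
  - by have [/andP[]] := sin_pqP R p q x hp hq x01.
rewrite integral_sin_cos_pq// ?lexx ?ltW ?pi_pq_half_gt0//.
rewrite sin_pq_pi_half// -integral_powR_onem_powR_beta// ?bE; last by lra.
by apply: eq_integral => s _; congr (_ * _ `^ _)%:E; rewrite addrAC subrr sub0r.
Qed.
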